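(* In the five-factor model with market prices of risk described in the context, let $w=(w^S,w^B,w^D)'\in\mathbb{R}^3$ be portfolio weights with $w'LCL'w>0$, and let $$R_t=\frac{w'L\lambda_t}{\sqrt{w'LCL'w}}$$ be the (instantaneous) Sharpe ratio of the portfolio. Then for every $t\ge0$, $R_t$ is normally distributed (possibly degenerate) with $$\mathsf{E}[R_t]=\frac{w'L\,\mathsf{E}[\lambda_t]}{\sqrt{w'LCL'w}},\qquad \mathsf{Var}[R_t]=\frac{w'MV(t)M'w}{w'LCL'w},$$ where $$\mathsf{E}[\lambda_t]=\begin{pmatrix}\bar x/\sigma_S\\ a(\bar r-b)/\sigma_r\\ k(\bar\pi-l)/\sigma_\pi\\ h/\sigma_I\end{pmatrix}+\begin{pmatrix}e^{-\alpha t}(x_0-\bar x)/\sigma_S\\ e^{-\kappa t}(a-\kappa)(r_0-\bar r)/\sigma_r\\ e^{-\beta t}(k-\beta)(\pi_0-\bar\pi)/\sigma_\pi\\ 0\end{pmatrix},$$ $$M=\begin{pmatrix}\sigma_x&0&0\\0&-\Psi(a,\tau_B)(a-\kappa)\sigma_r&0\\0&-\Psi(a,\tau_D)(a-\kappa)\sigma_r&\Psi(k,\tau_D)(k-\beta)\sigma_\pi\end{pmatrix},$$ $$V(t)=\begin{pmatrix}\Psi(2\alpha,t)&-\rho_{rS}\Psi(\kappa+\alpha,t)&-\rho_{S\pi}\Psi(\alpha+\beta,t)\\-\rho_{rS}\Psi(\kappa+\alpha,t)&\Psi(2\kappa,t)&\rho_{r\pi}\Psi(\kappa+\beta,t)\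\-\rho_{S\pi}\Psi(\alpha+\beta,t)&\rho_{r\pi}\Psi(\kappa+\beta,t)&\Psi(2\beta,t)\end{pmatrix}.$$
   Context: State variables: $dr_t=\kappa(\bar r-r_t)dt+\sigma_r dW^r_t$, $dx_t=\alpha(\bar x-x_t)dt-\sigma_x dW^S_t$, $d\pi_t=\beta(\bar\pi-\pi_t)dt+\sigma_\pi dW^\pi_t$, with given initial values $r_0,x_0,\pi_0$; real $\kappa,\alpha,\beta,\bar r,\bar x,\bar\pi$; $\sigma_x\ge0$ and $\sigma_S,\sigma_r,\sigma_\pi,\sigma_I>0$. Here $r$ is the short rate, $x$ the expected excess return of the stock index $dS_t/S_t=(r_t+x_t)dt+\sigma_SdW^S_t$, and $\pi$ the expected inflation of the price index $dI_t/I_t=\pi_tdt+\sigma_IdW^I_t$. The standard Brownian motions are jointly Gaussian; $(W^S,W^r,W^\pi,W^I)$ has correlation matrix $$C=\begin{pmatrix}1&\rho_{rS}&\rho_{S\pi}&0\\ \rho_{rS}&1&\rho_{r\pi}&0\\ \rho_{S\pi}&\rho_{r\pi}&1&0\\0&0&0&1\end{pmatrix}.$$ Market prices of risk, for real constants $a,b,h,k,l$: $\lambda_t=(\lambda^S_t,\lambda^r_t,\lambda^\pi_t,\lambda^I_t)'$ with $\lambda^S_t=x_t/\sigma_S$, $\lambda^r_t=\{(a-\kappa)r_t+\kappa\bar r-ab\}/\sigma_r$, $\lambda^\pi_t=\{(k-\beta)\pi_t+\beta\bar\pi-kl\}/\sigma_\pi$, $\lambda^I_t=h/\sigma_I$.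 The portfolio is continuously rebalanced to constant weights $w^S$ in stocks, $w^B$ in a constant-maturity nominal bond index of maturity $\tau_B>0$, $w^D$ in a constant-maturity inflation bond index of maturity $\tau_D>0$, and the rest in cash; its value satisfies $dV_t/V_t=[r_t+w'L\lambda_t]dt+w'L\,d(W^S_t,W^r_t,W^\pi_t,W^I_t)'$, where $$L=\begin{pmatrix}\sigma_S&0&0&0\\0&-\Psi(a,\tau_B)\sigma_r&0&0\\0&-\Psi(a,\tau_D)\sigma_r&\Psi(k,\tau_D)\sigma_\pi&\sigma_I\end{pmatrix}.$$ The function $\Psi$ is $\Psi(\kappa,t)=\int_0^te^{-\kappa u}du$, i.e. $t$ if $\kappa=0$ and $\frac1\kappa(1-e^{-\kappa t})$ if $\kappa\neq0$. A prime denotes transpose. *)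

(* Defs.v *)
From HB Require Import structures.
From mathcomp Require Import all_boot all_order all_algebra.
From mathcomp Require Import all_classical all_reals all_analysis.

Set Implicit Arguments.
Unset Strict Implicit.
Unset Printing Implicit Defensive.

Import Order.TTheory GRing.Theory Num.Theory.
Import numFieldNormedType.Exports.

Local Open Scope classical_set_scope.
Local Open Scope ring_scope.

Section Gaussian.
Context d (Omega : measurableType d) (R : realType) (P : probability Omega R).

(* X has the law N(m, v), where v is the variance; v = 0 gives the point mass
   at m.  The case split is needed because the library sets [normal_prob m 0]
   to the uniform law on [0, 1]. *)
Definition is_normal (X : Omega -> R) (m v : R) : Prop :=
  [/\ measurable_fun setT X, 0 <= v &
      forall A : set R, measurable A ->
        P (X @^-1` A) = if v == 0 then \d_m A else normal_prob m (Num.sqrt v) A].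

(* Taking some of the B k to be setT yields the product rule for subfamilies. *)
Definition mutually_independent (n : nat) (X : 'I_n -> Omega -> R) : Prop :=
  forall B : 'I_n -> set R, (forall k, measurable (B k)) ->
    P [set omega | forall k, B k (X k omega)] =
    (\prod_(k < n) P (X k @^-1` B k))%E.

(* Processes live on the time set [0, +oo[; their values at negative times are
   unconstrained junk. *)
Definition ae_continuous_paths (X : R -> {RV P >-> R}) : Prop :=
  {ae P, forall omega, {within `[0, +oo[, continuous (fun t => X t omega)}}.

Record standard_brownian_motion (W : R -> {RV P >-> R}) : Prop :=
  StandardBrownianMotion {
    sbm_start : {ae P, forall omega, W 0 omega = 0} ;
    sbm_continuous : ae_continuous_paths W ;
    sbm_increment : forall s t : R, 0 <= s -> s <= t ->
      is_normal (fun omega => W t omega - W s omega) 0 (t - s) ;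
    sbm_independent : forall (n : nat) (t : nat -> R), 0 <= t 0%N ->
      (forall k, t k <= t k.+1) ->
      mutually_independent
        (fun (k : 'I_n) omega => W (t k.+1) omega - W (t k) omega) }.

Definition jointly_gaussian (n : nat) (W : 'I_n -> R -> {RV P >-> R}) : Prop :=
  forall (q : nat) (i : 'I_q -> 'I_n) (t c : 'I_q -> R), (forall j, 0 <= t j) ->
    exists m v : R,
      is_normal (fun omega => \sum_(j < q) c j * W (i j) (t j) omega) m v.

(* Standard Brownian motions that are jointly Gaussian with (instantaneous)
   correlation matrix C: d<W^i, W^j>_t = C_ij dt.  For a Gaussian family this
   says that increments over the same time interval have correlation C_ij and
   increments over disjoint intervals are uncorrelated, i.e.
   Cov(W^i_s, W^j_t) = C_ij min(s, t). *)
Record correlated_brownian_motions (n : nat) (C : 'M[R]_n)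
    (W : 'I_n -> R -> {RV P >-> R}) : Prop := CorrelatedBrownianMotions {
  cbm_standard : forall i, standard_brownian_motion (W i) ;
  cbm_gaussian : jointly_gaussian W ;
  cbm_covariance : forall (i j : 'I_n) (s t : R), 0 <= s -> 0 <= t ->
    covariance P (W i s) (W j t) = (C i j * Num.min s t)%:E }.

(* dX_t = kappa (m - X_t) dt + s dB_t with X_0 = x0.  Since s is constant and
   B_0 = 0, the stochastic integral of s over [0, t] is s B_t, so the integral
   form of the equation is pathwise. *)
Definition solves_mean_reverting_sde (kappa m s x0 : R)
    (B X : R -> {RV P >-> R}) : Prop :=
  ae_continuous_paths X /\
  {ae P, forall omega, forall t : R, 0 <= t ->
    X t omega = x0
      + \int[lebesgue_measure]_(u in `[0, t]) (kappa * (m - X u omega))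
      + s * B t omega}.

End Gaussian.

Record parameters (R : realType) := FiveFactor {
  kappa : R ; rbar : R ; sigma_r : R ; r0 : R ;
  alpha : R ; xbar : R ; sigma_x : R ; x0 : R ;
  beta : R ; pibar : R ; sigma_pi : R ; pi0 : R ;
  sigma_S : R ; sigma_I : R ;
  rho_rS : R ; rho_Spi : R ; rho_rpi : R ;
  (* the constants a, b, h, k, l of the market prices of risk *)
  mpr_a : R ; mpr_b : R ; mpr_h : R ; mpr_k : R ; mpr_l : R ;
  tau_B : R ; tau_D : R }.

(* The order of the components is (W^S, W^r, W^pi, W^I). *)
Definition idx_S : 'I_4 := @Ordinal 4 0 isT.
Definition idx_r : 'I_4 := @Ordinal 4 1 isT.
Definition idx_pi : 'I_4 := @Ordinal 4 2 isT.
Definition idx_I : 'I_4 := @Ordinal 4 3 isT.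

Definition mx_of_rows (R : realType) (m n : nat) (rows : seq (seq R)) :
    'M[R]_(m, n) :=
  \matrix_(i < m, j < n) (nth [::] rows i)`_j.

Section Model.
Context (R : realType).

Definition Psi (c t : R) : R :=
  \int[lebesgue_measure]_(u in `[0, t]) expR (- (c * u)).

Variable p : parameters R.
Local Notation a := (mpr_a p).
Local Notation b := (mpr_b p).
Local Notation h := (mpr_h p).
Local Notation k := (mpr_k p).
Local Notation l := (mpr_l p).

Definition corr_mx : 'M[R]_4 := mx_of_rows 4 4
  [:: [:: 1;         rho_rS p;  rho_Spi p; 0];
      [:: rho_rS p;  1;         rho_rpi p; 0];
      [:: rho_Spi p; rho_rpi p; 1;         0];
      [:: 0;         0;         0;         1] ].

Definition L_mx : 'M[R]_(3, 4) := mx_of_rows 3 4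
  [:: [:: sigma_S p; 0; 0; 0];
      [:: 0; - Psi a (tau_B p) * sigma_r p; 0; 0];
      [:: 0; - Psi a (tau_D p) * sigma_r p; Psi k (tau_D p) * sigma_pi p;
          sigma_I p] ].

Definition M_mx : 'M[R]_3 := mx_of_rows 3 3
  [:: [:: sigma_x p; 0; 0];
      [:: 0; - Psi a (tau_B p) * (a - kappa p) * sigma_r p; 0];
      [:: 0; - Psi a (tau_D p) * (a - kappa p) * sigma_r p;
          Psi k (tau_D p) * (k - beta p) * sigma_pi p] ].

Definition V_mx (t : R) : 'M[R]_3 := mx_of_rows 3 3
  [:: [:: Psi (2 * alpha p) t;
          - rho_rS p * Psi (kappa p + alpha p) t;
          - rho_Spi p * Psi (alpha p + beta p) t];
      [:: - rho_rS p * Psi (kappa p + alpha p) t;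
          Psi (2 * kappa p) t;
          rho_rpi p * Psi (kappa p + beta p) t];
      [:: - rho_Spi p * Psi (alpha p + beta p) t;
          rho_rpi p * Psi (kappa p + beta p) t;
          Psi (2 * beta p) t] ].

(* lambda_t as a function of the state (r_t, x_t, pi_t) *)
Definition market_prices (rt xt pit : R) : 'cV[R]_4 := \col_(i < 4)
  [:: xt / sigma_S p;
      ((a - kappa p) * rt + kappa p * rbar p - a * b) / sigma_r p;
      ((k - beta p) * pit + beta p * pibar p - k * l) / sigma_pi p;
      h / sigma_I p]`_i.

Definition mean_market_prices (t : R) : 'cV[R]_4 :=
  (\col_(i < 4) [:: xbar p / sigma_S p;
                    a * (rbar p - b) / sigma_r p;
                    k * (pibar p - l) / sigma_pi p;
                    h / sigma_I p]`_i) +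
  (\col_(i < 4)
     [:: expR (- (alpha p * t)) * (x0 p - xbar p) / sigma_S p;
         expR (- (kappa p * t)) * (a - kappa p) * (r0 p - rbar p) / sigma_r p;
         expR (- (beta p * t)) * (k - beta p) * (pi0 p - pibar p) / sigma_pi p;
         0]`_i).

(* w' L C L' w *)
Definition portfolio_variance (w : 'cV[R]_3) : R :=
  (w^T *m L_mx *m corr_mx *m L_mx^T *m w) 0 0.

Definition sharpe_ratio (w : 'cV[R]_3) (lambda : 'cV[R]_4) : R :=
  (w^T *m L_mx *m lambda) 0 0 / Num.sqrt (portfolio_variance w).

End Model.

(* Main.v *)
(* Pathwise, an Ornstein-Uhlenbeck equation dX = c (m - X) dt + s dB on a grid of
   mesh h = t / n gives X_{k+1} - m = e^{-c h} (X_k - m) + s (B_{k+1} - B_k) + o(h)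
   uniformly in k, because the paths of X are uniformly continuous on [0, t];
   hence X_t - m - e^{-c t} (x_0 - m) is the almost sure limit of the weighted sums
   s sum_k e^{-c (t - t_{k+1})} (B_{k+1} - B_k), and no stochastic integral is
   needed.  Linear combinations of these sums for several equations are Gaussian
   because the Brownian motions are jointly Gaussian; they are centred, and their
   variances are Riemann sums converging to combinations of Psi (c_i + c_j, t).

   An almost sure limit of N(m, v_n) variables with v_n -> v has law N(m, v),
   v = 0 included: N(m, v) is in all cases the law of m + sqrt v * xi with xi
   standard normal, and m + sqrt v_n * xi -> m + sqrt v * xi pointwise.

   The Sharpe ratio is an affine function of (x_t, r_t, pi_t). *)
Require Import Defs.
From HB Require Import structures.
From mathcomp Require Import all_boot all_order all_algebra.
From mathcomp Require Import all_classical all_reals all_analysis.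
From mathcomp Require Import measurable_realfun.
From mathcomp Require Import zify ring lra.

Import Order.TTheory GRing.Theory Num.Theory.
Import numFieldNormedType.Exports.

Set Implicit Arguments.
Unset Strict Implicit.
Unset Printing Implicit Defensive.

Local Open Scope classical_set_scope.
Local Open Scope ring_scope.

(** * Normal laws *)

Section affine_image.
Context {R : realType}.
Local Notation mu := (@lebesgue_measure R).

Lemma affine_preimage_itvoc (m s a b : R) : 0 < s ->
  (fun y => m + s * y) @^-1` `]a, b] = `](a - m) / s, (b - m) / s]%classic.
Proof.
move=> s0; apply/seteqP; split => y /=; rewrite !in_itv/=.
  by rewrite ltr_pdivrMr// ler_pdivlMr// ltrBlDl lerBrDl mulrC.
by rewrite ltr_pdivrMr// ler_pdivlMr// ltrBlDl lerBrDl mulrC.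
Qed.

Lemma measurable_affine (m s : R) :
  measurable_fun setT ((fun y => m + s * y) : measurableTypeR R -> measurableTypeR R).
Proof. by apply: measurable_funD => //; exact: measurable_funM. Qed.

(** Both sides are measures in [A] that agree on half-open intervals, and these determine Lebesgue
    measure. *)
Lemma lebesgue_measure_affine (m s : R) (A : set R) : 0 < s -> measurable A ->
  mu A = (s%:E * mu ((fun y => m + s * y)%R @^-1` A))%E.
Proof.
move=> s0 mA.
pose f : measurableTypeR R -> measurableTypeR R := fun y => m + s * y.
have mf : measurable_fun setT f := measurable_affine m s.
pose k := NngNum (ltW s0).
apply: (@lebesgue_measure_unique _ (mscale k (pushforward mu f))) => //.
move=> _ [[a b]] _ <-/=.
rewrite /mscale/= /pushforward affine_preimage_itvoc// !lebesgue_measure_itv/=.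
rewrite !lte_fin ltr_pM2r ?invr_gt0// ltrD2r; case: ifPn => _; last by rewrite mule0.
by rewrite -!EFinD -EFinM -mulrBl mulrCA divff ?gt_eqF// mulr1; congr EFin; ring.
Qed.

(** Under the substitution x = m + s y, the factor s from Lebesgue measure cancels the 1/s in the
    peak of the density. *)
Lemma normal_prob_affine (m s : R) (A : set R) : 0 < s -> measurable A ->
  normal_prob m s A = normal_prob 0 1 ((fun y => m + s * y) @^-1` A).
Proof.
move=> s0 mA; rewrite /normal_prob.
pose f : measurableTypeR R -> measurableTypeR R := fun y => m + s * y.
have mf : measurable_fun setT f := measurable_affine m s.
pose k := NngNum (ltW s0).
have mp : measurable_fun A (fun x => (normal_pdf m s x)%:E).
  by apply/measurable_EFinP/measurable_funTS; exact: measurable_normal_pdf.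
transitivity (s%:E * \int[mu]_(x in f @^-1` A)
    (((fun y => (normal_pdf m s y)%:E) \o f) x))%E; last first.
  rewrite -ge0_integralZl//; last 4 first.
  - by rewrite -[X in measurable X]setTI; exact: mf.
  - apply/measurable_EFinP/measurable_funTS; apply: measurableT_comp => //.
    exact: measurable_normal_pdf.
  - by move=> x _; rewrite lee_fin normal_pdf_ge0.
  - by rewrite lee_fin ltW.
  apply: eq_integral => x _; rewrite -EFinM; congr EFin.
  rewrite !normal_pdfE ?oner_eq0 ?gt_eqF// /normal_peak /normal_fun /f/=.
  rewrite expr1n -mulrnAr sqrtrM ?sqr_ge0// sqrtr_sqr gtr0_norm//.
  rewrite addrAC subrr add0r subr0 mul1r invfM mulrA mulrA divff ?gt_eqF// mul1r.
  congr (_ * expR _).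
  rewrite exprMn -[_ *+ 2]mulr_natr invfM !mulNr mulrACA divff ?mul1r//.
  by rewrite sqrf_eq0 gt_eqF.
rewrite -(ge0_integral_pushforward mf)//; last first.
  by move=> x _; rewrite lee_fin normal_pdf_ge0.
have H := @ge0_integral_mscale _ (measurableTypeR R) R (pushforward mu f) A mA k
  _ mp.
apply: (etrans _ (H mf _)); last by move=> x _; rewrite lee_fin normal_pdf_ge0.
apply: eq_measure_integral => /= B mB BA.
by rewrite (lebesgue_measure_affine m s0).
Qed.

(** Lebesgue measure is invariant under reflection and the density is even. *)
Lemma normal_prob01_opp (A : set R) : measurable A ->
  normal_prob 0 1 (-%R @^-1` A) = normal_prob 0 1 A :> \bar R.
Proof.
move=> mA; rewrite /normal_prob.
transitivity (\int[pushforward mu (-%R : _ -> measurableTypeR R)]_(x in A)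
    (normal_pdf 0 1 x)%:E)%E; last first.
  by apply: eq_measure_integral => /= B mB BA; rewrite lebesgue_measureN.
rewrite ge0_integral_pushforward//; last 2 first.
- by apply/measurable_EFinP/measurable_funTS; exact: measurable_normal_pdf.
- by move=> x _; rewrite lee_fin normal_pdf_ge0.
apply: eq_integral => x _ /=; congr EFin.
by rewrite !normal_pdfE ?oner_eq0// /normal_fun !subr0 sqrrN.
Qed.

End affine_image.

(** * Second moment of the standard normal law *)

Section normal_integral.
Context {R : realType}.
Local Notation mu := (@lebesgue_measure R).

(** The Radon-Nikodym derivative agrees almost everywhere with the density, because both have the
    same integral over every measurable set. *)
Lemma ge0_integral_normal_prob (m s : R) (f : R -> \bar R) :
  measurable_fun setT f -> (forall x, 0 <= f x)%E ->
  (\int[normal_prob m s]_x f x = \int[mu]_x (f x * (normal_pdf m s x)%:E))%E.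
Proof.
move=> mf f0; have dom := normal_prob_dominates m s.
rewrite -(Radon_Nikodym_SigmaFinite.change_of_variables dom f0 measurableT mf).
have intd := Radon_Nikodym_SigmaFinite.f_integrable dom.
apply: ae_eq_integral => //.
- apply: emeasurable_funM => //; exact: (measurable_int mu).
- apply: emeasurable_funM => //; apply/measurable_EFinP.
  exact: measurable_normal_pdf.
- apply: ae_eqe_mul2l; apply: integral_ae_eq => //.
  + by apply/measurable_EFinP; exact: measurable_normal_pdf.
  + by move=> E _ mE; rewrite -Radon_Nikodym_SigmaFinite.f_integral.
Qed.

Let phi : R -> R := normal_pdf 0 1.

Let phiE x : phi x = normal_peak 1 * expR (- (x ^+ 2 / 2)).
Proof.
rewrite /phi normal_pdfE ?oner_eq0// /normal_fun subr0 expr1n.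
by rewrite mulNr.
Qed.

Let is_derive_phi (x : R) : is_derive x (1 : R) phi (- (x * phi x)).
Proof.
rewrite (_ : phi = fun x => normal_peak 1 * expR (- (x ^+ 2 / 2))); last first.
  by apply/funext => y; rewrite phiE.
apply: is_derive_eq; rewrite /GRing.scale/=.
by field.
Qed.

Let cphi : continuous phi.
Proof. by apply: continuous_normal_pdf; rewrite oner_eq0. Qed.

Let phi_ge0 x : 0 <= phi x. Proof. exact: normal_pdf_ge0. Qed.

Let is_derive_xphi (x : R) :
  is_derive x (1 : R) (fun y : R => y * phi y) ((1 - x ^+ 2) * phi x).
Proof.
have H := is_derive_phi x.
apply: is_derive_eq; rewrite /GRing.scale/=; ring.
Qed.

Let cvg_xphi : x * phi x @[x --> +oo] --> (0 : R).
Proof.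
apply: (@squeeze_cvgr _ _ _ _ (fun=> 0) (fun x => 2 * normal_peak 1 * x^-1)).
- near=> x.
  have x0 : 0 < x by near: x; exact: nbhs_pinfty_gt.
  rewrite mulr_ge0 ?phi_ge0 ?(ltW x0)//=.
  (* This follows from 1 + u <= e^u at u = x^2 / 2, and makes x phi(x) of order 1/x. *)
  have : expR (- (x ^+ 2 / 2)) <= 2 * x^-1 ^+ 2.
    have x2 : 0 < 2 * x^-1 ^+ 2 by rewrite mulr_gt0// exprn_gt0// invr_gt0.
    rewrite expRN -[leRHS]invrK lef_pV2 ?posrE ?expR_gt0 ?invr_gt0//.
    rewrite exprVn invfM invrK mulrC (le_trans _ (expR_ge1Dx _))//.
    by rewrite lerDr.
  rewrite phiE [x * (_ * _)]mulrCA => /(ler_wpM2l (ltW x0)).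
  move=> /(ler_wpM2l (normal_peak_ge0 1)) /le_trans; apply.
  rewrite le_eqVlt; apply/orP; left; apply/eqP; field.
  by rewrite gt_eqF.
- exact: cvg_cst.
- rewrite -[X in _ --> X](mulr0 (2 * normal_peak 1)).
  apply: cvgM; first exact: cvg_cst.
  apply/gtr0_cvgV0; last exact: cvg_id.
  exact: nbhs_pinfty_gt.
Unshelve. all: by end_near. Qed.

(* The primitive - y phi(y) of (y^2 - 1) phi(y) vanishes at 0 and at +oo, so
   y^2 phi and phi have the same integral over [0, +oo[; the half-line is cut at 1,
   where y^2 - 1 changes sign. *)
Let integral01_phi : (\int[mu]_(x in `[0%R, 1%R]) (phi x)%:E =
  (phi 1)%:E + \int[mu]_(x in `[0%R, 1%R]) (x ^+ 2 * phi x)%:E)%E.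
Proof.
have <- : (\int[mu]_(x in `[0%R, 1%R]) ((1 - x ^+ 2) * phi x)%:E)%E = (phi 1)%:E.
  rewrite (@continuous_FTC2 _ _ (fun y => y * phi y))//=.
  - by rewrite mul1r mul0r sube0.
  - apply: continuous_subspaceT => x; apply: cvgM; last exact: cphi.
    by apply: cvgB; [exact: cvg_cst|exact: exprn_continuous].
  - split.
    + by move=> x _; have [] := is_derive_xphi x.
    + by apply: cvg_at_right_filter; apply: cvgM; [exact: cvg_id|exact: cphi].
    + by apply: cvg_at_left_filter; apply: cvgM; [exact: cvg_id|exact: cphi].
  - move=> x _; rewrite derive1E; have H := is_derive_xphi x.
    by rewrite derive_val.
rewrite -ge0_integralD//=.
- by apply: eq_integral => x _; rewrite -EFinD; congr EFin; ring.
- move=> x; rewrite in_itv/= => /andP[x0 x1].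
  by rewrite lee_fin mulr_ge0 ?phi_ge0// subr_ge0 exprn_ile1.
- apply/measurable_EFinP/measurable_funTS/measurable_funM.
    exact: measurable_funB.
  exact: measurable_normal_pdf.
- by move=> x _; rewrite lee_fin mulr_ge0 ?phi_ge0// sqr_ge0.
- apply/measurable_EFinP/measurable_funTS/measurable_funM => //.
  exact: measurable_normal_pdf.
Qed.

Let integral1y_phi : (\int[mu]_(x in `[1%R, +oo[) (x ^+ 2 * phi x)%:E =
  (phi 1)%:E + \int[mu]_(x in `[1%R, +oo[) (phi x)%:E)%E.
Proof.
have <- : (\int[mu]_(x in `[1%R, +oo[) ((x ^+ 2 - 1) * phi x)%:E)%E = (phi 1)%:E.
  rewrite (@ge0_continuous_FTC2y _ _ (fun y => - (y * phi y)) _ 0)//=.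
  - by rewrite mul1r opprK add0e.
  - move=> x x1; rewrite mulr_ge0 ?phi_ge0// subr_ge0 -(expr1n _ 2).
    by rewrite ler_sqr ?nnegrE// (le_trans _ x1).
  - apply: continuous_subspaceT => x; apply: cvgM; last exact: cphi.
    by apply: cvgB; [exact: exprn_continuous|exact: cvg_cst].
  - by rewrite -oppr0; apply: cvgN; exact: cvg_xphi.
  - by move=> x _; apply: derivableN; have [] := is_derive_xphi x.
  - apply: cvg_at_right_filter; apply: cvgN.
    by apply: cvgM; [exact: cvg_id|exact: cphi].
  - move=> x _; rewrite derive1E; have H := is_derive_xphi x.
    by rewrite deriveN// derive_val; ring.
rewrite -ge0_integralD//=.
- by apply: eq_integral => x _; rewrite -EFinD; congr EFin; ring.
- move=> x; rewrite in_itv/= andbT => x1.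
  rewrite lee_fin mulr_ge0 ?phi_ge0// subr_ge0 -(expr1n _ 2).
  by rewrite ler_sqr ?nnegrE// (le_trans _ x1).
- apply/measurable_EFinP/measurable_funTS/measurable_funM.
    exact: measurable_funB.
  exact: measurable_normal_pdf.
- by move=> x _; rewrite lee_fin phi_ge0.
- by apply/measurable_EFinP/measurable_funTS; exact: measurable_normal_pdf.
Qed.

Let integral_half_line (g : R -> R) : (forall x, 0 <= g x) -> measurable_fun setT g ->
  (\int[mu]_(x in [set x | 0 <= x]%R) (g x)%:E =
   \int[mu]_(x in `[0%R, 1%R]) (g x)%:E + \int[mu]_(x in `[1%R, +oo[) (g x)%:E)%E.
Proof.
move=> g0 mg.
(* The point 1 is dropped from the second interval to make the two pieces disjoint. *)
rewrite -(@integral_itv_obnd_cbnd _ 1)//; last first.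
  by apply/measurable_EFinP/measurable_funTS.
rewrite -ge0_integral_setU//=.
- congr (integral _ _ _); rewrite -set_itvcy.
  by rewrite -itv_bndbnd_setU// bnd_simp.
- by apply/measurable_EFinP/measurable_funTS.
- by move=> x _; rewrite lee_fin.
- apply/disj_setPS => y [/=]; rewrite !in_itv/= andbT => /andP[_ y1].
  by rewrite ltNge y1.
Qed.

Lemma integral_sqr_normal_prob01 :
  (\int[normal_prob 0 1]_x (x ^+ 2 : R)%:E = 1)%E.
Proof.
rewrite ge0_integral_normal_prob//; last 2 first.
- exact/measurable_EFinP/measurable_funX.
- by move=> x; rewrite lee_fin sqr_ge0.
(* The 1 on the right becomes the integral of the density. Both integrands are even, which leaves
   the half-line, where the terms [phi 1] of the two pieces compensate each other. *)
rewrite -(integral_normal_pdf 0 1).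
have phiN : phi =1 phi \o -%R by move=> x; rewrite /= !phiE sqrrN.
rewrite [RHS]ge0_symfun_integralT//.
under eq_integral do rewrite -EFinM.
rewrite [LHS]ge0_symfun_integralT//.
- rewrite !integral_half_line//.
  + by rewrite integral01_phi integral1y_phi; congr (_ * _)%E; rewrite addeA [(_ + (phi 1)%:E)%E]addeC.
  + exact: measurable_normal_pdf.
  + by move=> x; rewrite mulr_ge0 ?sqr_ge0 ?phi_ge0.
  + by apply: measurable_funM => //; exact: measurable_normal_pdf.
- by move=> x; rewrite mulr_ge0 ?sqr_ge0 ?phi_ge0.
- by move=> x; apply: cvgM; [exact: exprn_continuous|exact: cphi].
- by move=> x /=; rewrite sqrrN; congr (_ * _); exact: phiN.
Qed.

End normal_integral.

(** * Equality in law *)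

Lemma Lfun2_sqr_lty d (T : measurableType d) (R : realType)
    (m : {measure set T -> \bar R}) (f : T -> R) :
  measurable_fun setT f -> (\int[m]_x (f x ^+ 2)%:E < +oo)%E ->
  f \in Lfun m 2%:E.
Proof.
move=> mf fy; rewrite inE; apply/andP; split; rewrite inE//=.
rewrite /finite_norm unlock /Lnorm poweR_lty//.
rewrite (eq_integral (fun x => (f x ^+ 2)%:E))// => x _ /=.
by rewrite powR_mulrn// real_normK// num_real.
Qed.

Section equality_in_law.
Context d (Omega : measurableType d) d' (T : measurableType d') {R : realType}.
Context (P : probability Omega R) (Q : probability T R).

(** The two variables may live on different probability spaces, so that [X] can be compared with an
    explicit function on the real line under N(0, 1). *)
Definition eq_law (X : Omega -> R) (Y : T -> R) : Prop :=
  forall A : set R, measurable A -> P (X @^-1` A) = Q (Y @^-1` A).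

(** For nonnegative functions both sides are integrals against the common image law; the general
    case splits [f] into its positive and negative parts. *)
Lemma eq_law_integral (X : Omega -> R) (Y : T -> R) (f : R -> \bar R) :
  measurable_fun setT X -> measurable_fun setT Y -> eq_law X Y ->
  measurable_fun setT f ->
  (\int[P]_w f (X w) = \int[Q]_w f (Y w))%E.
Proof.
move=> mX mY XY mf.
have ge0 g : measurable_fun setT g -> (forall x, 0 <= g x)%E ->
    (\int[P]_w g (X w) = \int[Q]_w g (Y w))%E.
  move=> mg g0.
  rewrite -(preimage_setT X) -(preimage_setT Y).
  rewrite -[LHS](ge0_integral_pushforward mX P measurableT mg)//.
  rewrite -[RHS](ge0_integral_pushforward mY Q measurableT mg)//.
  by apply: eq_measure_integral => /= A mA _; exact: XY.
rewrite -[fun w => f (X w)]/(f \o X) -[fun w => f (Y w)]/(f \o Y).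
rewrite [LHS]integralE [RHS]integralE (funepos_comp f X) (funepos_comp f Y).
rewrite (funeneg_comp f X) (funeneg_comp f Y).
congr (_ - _)%E.
- by apply: (ge0 (f^\+)%E) => //; exact: measurable_funepos.
- by apply: (ge0 (f^\-)%E) => //; exact: measurable_funeneg.
Qed.

(** Continuous functions with values in [0, 1] that increase with [k] to the indicator of the open
    ray below [b]. *)
Let ramp (b : R) (k : nat) (x : R) : R := Num.min 1 (k%:R * Num.max 0 (b - x)).

Let ramp_ge0 b k x : 0 <= ramp b k x.
Proof. by rewrite le_min ler01/= mulr_ge0// le_max lexx. Qed.

Let ramp_le1 b k x : ramp b k x <= 1.
Proof. by rewrite ge_min lexx. Qed.

Let continuous_ramp b k : continuous (ramp b k).
Proof.
move=> x.
apply: (@continuous_min _ _ (fun=> 1) (fun x => k%:R * Num.max 0 (b - x)) x).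
  exact: cvg_cst.
apply: cvgM; first exact: cvg_cst.
apply: (@continuous_max _ _ (fun=> 0) (fun x => b - x) x); first exact: cvg_cst.
by apply: cvgB; [exact: cvg_cst|exact: cvg_id].
Qed.

Let measurable_ramp b k : measurable_fun setT (ramp b k).
Proof. exact: continuous_measurable_fun. Qed.

Let cvg_ramp b x : ramp b k x @[k --> \oo] --> (\1_(`]-oo, b[%classic) x : R).
Proof.
rewrite indicE; have [xb|bx] := ltP x b.
  rewrite mem_set/= ?in_itv//=.
  apply: cvg_near_cst; near=> k.
  rewrite /ramp max_r ?subr_ge0 ?(ltW xb)// min_l// -ler_pdivrMr ?subr_gt0// mul1r.
  near: k; exact: nbhs_infty_ger.
rewrite memNset/= ?in_itv/=; last by rewrite ltNge bx.
apply: cvg_near_cst; near=> k.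
by rewrite /ramp max_l ?subr_le0// mulr0 min_r.
Unshelve. all: by end_near. Qed.

Let cvg_integral_comp d0 (S : measurableType d0) (M : probability S R)
    (Z_ : nat -> S -> R) (Z : S -> R) (f : R -> R) :
  (forall n, measurable_fun setT (Z_ n)) -> measurable_fun setT Z ->
  {ae M, forall w, Z_ n w @[n --> \oo] --> Z w} ->
  continuous f -> (forall x, 0 <= f x <= 1) ->
  (\int[M]_w (f (Z_ n w))%:E @[n --> \oo] --> \int[M]_w (f (Z w))%:E)%E.
Proof.
move=> mZ_ mZ ZZ cf f01.
have mf : measurable_fun setT f by exact: continuous_measurable_fun.
have [] := @dominated_convergence _ _ _ M setT measurableT
  (fun n w => (f (Z_ n w))%:E) (fun w => (f (Z w))%:E) (cst 1%E) => //.
- by move=> n; apply/measurable_EFinP; exact: measurableT_comp.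
- by apply/measurable_EFinP; exact: measurableT_comp.
- apply: filterS ZZ => w Zw _; apply: cvg_EFin; first exact: nearW.
  exact: (cvg_comp _ _ Zw (cf (Z w))).
- exact: finite_measure_integrable_cst.
- apply: aeW => w n _; rewrite lee_fin ger0_norm//.
    by have /andP[] := f01 (Z_ n w).
  by have /andP[] := f01 (Z_ n w).
Qed.

(** By dominated convergence, the limits have equal expectations of continuous functions with values
    in [0, 1]. The ramps then give equal probabilities of open rays, which are stable under
    intersection and generate the Borel sets. *)
Lemma eq_law_lim (X_ : nat -> Omega -> R) (X : Omega -> R)
    (Y_ : nat -> T -> R) (Y : T -> R) :
  (forall n, measurable_fun setT (X_ n)) -> measurable_fun setT X ->
  (forall n, measurable_fun setT (Y_ n)) -> measurable_fun setT Y ->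
  (forall n, eq_law (X_ n) (Y_ n)) ->
  {ae P, forall w, X_ n w @[n --> \oo] --> X w} ->
  {ae Q, forall w, Y_ n w @[n --> \oo] --> Y w} ->
  eq_law X Y.
Proof.
move=> mX_ mX mY_ mY XY_ cX cY.
have eqf (f : R -> R) : continuous f -> (forall x, 0 <= f x <= 1) ->
    (\int[P]_w (f (X w))%:E = \int[Q]_w (f (Y w))%:E)%E.
  move=> cf f01.
  have := cvg_integral_comp mX_ mX cX cf f01.
  rewrite (_ : (fun n => _) = fun n => (\int[Q]_w (f (Y_ n w))%:E)%E); last first.
    apply/funext => n; apply: (@eq_law_integral _ _ (EFin \o f)) => //.
    by apply/measurable_EFinP; exact: continuous_measurable_fun.
  move=> /cvg_unique; apply; first exact: ereal_hausdorff.
  exact: cvg_integral_comp.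
have lim_ramp d0 (S : measurableType d0) (M : probability S R) (Z : S -> R) b :
    measurable_fun setT Z ->
    (\int[M]_w (ramp b k (Z w))%:E @[k --> \oo] --> M (Z @^-1` `]-oo, b[%classic))%E.
  move=> mZ.
  have mb : measurable (Z @^-1` `]-oo, b[%classic).
    by rewrite -[X in measurable X]setTI; exact: mZ.
  have [] := @dominated_convergence _ _ _ M setT measurableT
    (fun k w => (ramp b k (Z w))%:E)
    (fun w => (\1_(`]-oo, b[%classic) (Z w) : R)%:E) (cst 1%E) => //.
  - by move=> n; apply/measurable_EFinP; exact: measurableT_comp.
  - by apply/measurable_EFinP; apply: measurableT_comp mZ; exact: measurable_indic.
  - apply: aeW => w _; apply: cvg_EFin; first exact: nearW.
    exact: cvg_ramp.
  - exact: finite_measure_integrable_cst.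
  - by apply: aeW => w n _; rewrite lee_fin ger0_norm ?ramp_ge0 ?ramp_le1.
  by rewrite (_ : (fun w => (\1_`]-oo, b[ (Z w))%:E) =
    (fun w => (\1_(Z @^-1` `]-oo, b[%classic) w)%:E))// integral_indic// setIT.
have eqray b : P (X @^-1` `]-oo, b[%classic) = Q (Y @^-1` `]-oo, b[%classic).
  have := lim_ramp _ _ P X b mX.
  rewrite (_ : (fun k => _) = fun k => (\int[Q]_w (ramp b k (Y w))%:E)%E); last first.
    by apply/funext => k; apply: eqf => // x; rewrite ramp_ge0 ramp_le1.
  move=> /cvg_unique; apply; first exact: ereal_hausdorff.
  exact: lim_ramp.
move=> A mA.
have := @measure_unique _ (measurableTypeR R) R (@RGenInftyO.G R)
  (fun k => `]-oo, k%:R[%classic) (@RGenInftyO.measurableE R) _ _ _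
  (pushforward P X) (pushforward Q Y).
apply => //.
- move=> _ _ [x ->] [y ->]; exists (Num.min x y).
  apply/seteqP; split => z /=; rewrite !in_itv/= lt_min.
    by move=> [-> ->].
  by move=> /andP[].
- by move=> k; exists k%:R.
- rewrite -subTset => z _; exists (Num.truncn `|z|).+1 => //=.
  by rewrite in_itv/= (le_lt_trans (ler_norm z))// truncnS_gt.
- by move=> _ [x ->]; exact: eqray.
- move=> k; apply: (@le_lt_trans _ _ 1%E); last exact: ltry.
  by apply: probability_le1; rewrite -[X in measurable X]setTI; exact: mX.
Qed.

End equality_in_law.

(** * Integrability and mean of the standard normal law *)

Section standard_normal.
Context {R : realType}.
Local Notation N01 := (normal_prob (0 : R) 1).

Lemma Lfun2_id_normal01 : (fun x : R => x) \in Lfun N01 2%:E.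
Proof.
by apply: Lfun2_sqr_lty => //; rewrite integral_sqr_normal_prob01 ltry.
Qed.

(** By symmetry the mean equals its opposite; square integrability makes it finite, hence zero. *)
Lemma expectation_id_normal01 : ('E_(N01)[fun x : R => x] = 0)%E.
Proof.
have opp : (\int[N01]_x (x : R)%:E = \int[N01]_x (- x)%:E)%E.
  have law : eq_law N01 N01 (fun x => x) (fun x => - x).
    by move=> A mA; rewrite [RHS]normal_prob01_opp.
  have mid : measurable_fun setT (fun x : measurableTypeR R => x : R) by [].
  have mopp : measurable_fun setT (fun x : measurableTypeR R => - x : R) by exact: measurable_funN.
  exact: (eq_law_integral (f := EFin) mid mopp law).
have L1 : (fun x : R => x) \in Lfun N01 1.
  by apply: (Lfun_subset12 _ Lfun2_id_normal01); exact: fin_num_measure.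
have fE := expectation_fin_num L1.
move: opp fE; rewrite unlock.
have /Lfun1_integrable iid := L1.
have -> : (\int[N01]_x (- x)%:E = - \int[N01]_x (x : R)%:E)%E.
  by rewrite -integralN//=; apply: integrable_add_def.
case: (integral _ _ _) => [r| |]//.
by move=> [/eqP]; rewrite -addr_eq0 -mulr2n mulrn_eq0/= => /eqP ->.
Qed.

End standard_normal.

(** * Normal laws as affine images of the standard one *)

Section normal_law.
Context d (Omega : measurableType d) {R : realType} (P : probability Omega R).
Local Notation N01 := (normal_prob (0 : R) 1).

(** Removes the case split on the variance: at [v = 0] the affine map is constant and its image law
    is the point mass at [m]. *)
Lemma is_normalP (X : Omega -> R) (m v : R) : is_normal P X m v <->
  [/\ measurable_fun setT X, 0 <= v &
      eq_law P N01 X (fun y => m + Num.sqrt v * y)].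
Proof.
have H (A : set R) : 0 <= v -> measurable A ->
    (if v == 0 then \d_m A else normal_prob m (Num.sqrt v) A) =
    N01 ((fun y => m + Num.sqrt v * y) @^-1` A).
  move=> v0 mA; case: eqVneq => [->|vn0]; last first.
    by rewrite normal_prob_affine// sqrtr_gt0 lt0r vn0.
  rewrite sqrtr0 diracE; have [mA'|mA'] := boolP (m \in A).
    rewrite (_ : _ @^-1` A = setT) ?probability_setT//.
    by apply/seteqP; split => // y _ /=; rewrite mul0r addr0; exact: set_mem.
  rewrite (_ : _ @^-1` A = set0) ?measure0//.
  apply/seteqP; split => // y /=; rewrite mul0r addr0 => /mem_set.
  by rewrite (negbTE mA').
by split => -[mX v0 XA]; split => // A mA; rewrite XA// H.
Qed.

Lemma is_normal_shift (X : Omega -> R) (a m v : R) :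
  is_normal P X m v -> is_normal P (fun w => a + X w) (a + m) v.
Proof.
move=> /is_normalP[mX v0 XN]; apply/is_normalP; split => //.
  exact: measurable_funD.
move=> A mA.
have ma : measurable_fun setT (fun y : R => a + y) by exact: measurable_funD.
have mB : measurable ((fun y => a + y) @^-1` A).
  by rewrite -[X in measurable X]setTI; exact: ma.
rewrite [LHS](XN _ mB); congr (N01 _).
by apply/seteqP; split => y /=; rewrite addrA.
Qed.

(** Moments depend only on the law, so they are computed for m + sqrt v * y under N(0, 1). *)
Lemma is_normal_moments (X : Omega -> R) (m v : R) : is_normal P X m v ->
  [/\ X \in Lfun P 2%:E, ('E_P[X] = m%:E)%E & ('V_P[X] = v%:E)%E].
Proof.
move=> /is_normalP[mX v0 XN].
set Y : measurableTypeR R -> R := fun y => m + Num.sqrt v * y in XN.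
have mY : measurable_fun setT Y.
  by apply: measurable_funD => //; exact: measurable_funM.
have YE : Y = cst m \+ (Num.sqrt v \o* (fun x : measurableTypeR R => x : R)).
  by apply/funext => y; rewrite /Y /= [_ * y]mulrC.
have Lid : (Num.sqrt v \o* (fun x : measurableTypeR R => x : R)) \in Lfun N01 2%:E.
  by rewrite Lfun_scale ?ler1n// Lfun2_id_normal01.
have L2 : Y \in Lfun N01 2%:E.
  by rewrite YE rpredD ?lee1n//= => *; rewrite Lfun_cst.
have fin1 : N01 setT \is a fin_num by exact: fin_num_measure.
have E : ('E_P[X] = m%:E)%E.
  transitivity ('E_(N01)[Y])%E.
    by rewrite unlock; exact: (eq_law_integral (f := EFin) mX mY XN).
  rewrite YE expectationD ?expectation_cst; last 2 first.
  - by rewrite Lfun_cst.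
  - exact: (Lfun_subset12 fin1 Lid).
  rewrite expectationZl ?expectation_id_normal01 ?mule0 ?adde0//.
  exact: (Lfun_subset12 fin1 Lfun2_id_normal01).
have V (c : R) : (\int[P]_w ((X w - c) ^+ 2)%:E = \int[N01]_w ((Y w - c) ^+ 2)%:E)%E.
  apply: (eq_law_integral (f := fun x => ((x - c) ^+ 2)%:E) mX mY XN).
  by apply/measurable_EFinP/measurable_funX; exact: measurable_funB.
split => //.
- apply: Lfun2_sqr_lty => //.
  rewrite (eq_law_integral (f := fun x => (x ^+ 2)%:E) mX mY XN).
    exact: (integrable_lty measurableT (Lfun2_integrable_sqr L2)).
  exact/measurable_EFinP/measurable_funX.
- rewrite /variance unlock E /= unlock.
  rewrite (_ : (fun w => _) = fun w => ((X w - m) ^+ 2)%:E); last first.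
    by apply/funext => w; rewrite expr2.
  rewrite V.
  under eq_integral do rewrite /Y addrAC subrr add0r exprMn sqr_sqrtr// EFinM.
  rewrite ge0_integralZl//=.
  + by rewrite integral_sqr_normal_prob01 mule1.
  + exact/measurable_EFinP/measurable_funX.
  + by move=> y _; rewrite lee_fin sqr_ge0.
Qed.

(** The variables m + sqrt v_n * y converge at every y since the square root is continuous;
    [eq_law_lim] applies with the real line as second space. *)
Lemma is_normal_lim (X_ : nat -> Omega -> R) (X : Omega -> R)
    (m v : R) (v_ : nat -> R) :
  (forall n, is_normal P (X_ n) m (v_ n)) -> measurable_fun setT X ->
  {ae P, forall w, X_ n w @[n --> \oo] --> X w} ->
  v_ n @[n --> \oo] --> v -> is_normal P X m v.
Proof.
move=> XN mX XX vv.
have v_ge0 n : 0 <= v_ n by case: (XN n).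
have maff s : measurable_fun setT (fun y : measurableTypeR R => m + s * y).
  by apply: measurable_funD => //; exact: measurable_funM.
apply/is_normalP; split => //.
  apply: (@cvgr_to_ge _ \oo _ _ _ _ _ vv); exact: nearW.
apply: (@eq_law_lim _ _ _ _ _ _ _ X_ X (fun n (y : measurableTypeR R) => m + Num.sqrt (v_ n) * y)) => //.
- by move=> n; case: (XN n).
- by move=> n; have /is_normalP[] := XN n.
- apply: aeW => y; apply: cvgD; first exact: cvg_cst.
  apply: cvgM; last exact: cvg_cst.
  exact: (cvg_comp _ _ vv (@sqrt_continuous _ _)).
Qed.

Lemma ae_eq_is_normal (X Y : Omega -> R) (m v : R) :
  measurable_fun setT Y -> {ae P, forall w, X w = Y w} ->
  is_normal P X m v -> is_normal P Y m v.
Proof.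
move=> mY XY XN; apply: (@is_normal_lim (fun=> X) Y m v (fun=> v)) => //.
  by apply: filterS XY => w ->; exact: cvg_cst.
exact: cvg_cst.
Qed.

End normal_law.

(** * Discretized mean-reverting equations *)

Section discretization.
Context {R : realType}.
Local Notation mu := (@lebesgue_measure R).
Implicit Types (g B X : R -> R) (t c : R).

(** Heine-Cantor, with compactness in its near-covering form: radii that work near each point yield
    one that works on the whole segment. *)
Lemma within_continuous_unif g (a b : R) : {within `[a, b], continuous g} ->
  forall e, 0 < e -> exists2 r, 0 < r & forall x y, x \in `[a, b] -> y \in `[a, b] ->
    `|x - y| < r -> `|g x - g y| < e.
Proof.
move=> cg e e0.
pose Q (r x : R) := x \in `[a, b] -> forall y, y \in `[a, b] ->
  `|x - y| < r -> `|g x - g y| < e.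
have cov (x : R) : `[a, b]%classic x -> \forall x' \near x & r \near 0^'+, Q r x'.
  move=> xab; have /subspace_continuousP/(_ x xab) := cg.
  move=> /cvgrPdist_lt/(_ (e / 2)).
  rewrite divr_gt0// => /(_ isT) /nbhs_ballP[r /= r0 xr].
  have gx z : z \in `[a, b] -> `|x - z| < r -> `|g x - g z| < e / 2.
    by move=> zab xz; apply: xr.
  near=> x' r' => x'ab y yab x'y.
  have xx' : `|x - x'| < r / 2.
    by near: x'; exists (r / 2) => //=; rewrite divr_gt0.
  have rr : r' < r / 2 by near: r'; apply: nbhs_right_lt; rewrite divr_gt0.
  rewrite (splitr e) (le_lt_trans (ler_distD (g x) _ _))// ltrD//.
    by rewrite distrC gx// (lt_le_trans xx')// ler_pdivrMr// ler_peMr ?ler1n// ltW.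
  rewrite gx// (le_lt_trans (ler_distD x' _ _))// (splitr r) ltrD//.
  exact: lt_trans rr.
have /compact_near_coveringP/(_ R (0^'+) Q _ cov) := @segment_compact R a b.
move=> H; near (0 : R)^'+ => r; exists r => // x y xab yab xy.
by apply: (near H r) => //=.
Unshelve. all: by end_near. Qed.

(** Once the mesh is below the modulus of uniform continuity, [g] stays within [e] of its left
    endpoint value on every cell, so the threshold for [n] is the same for all [k]. *)
Lemma Riemann_step g t : 0 <= t -> {within `[0, t], continuous g} ->
  forall e, 0 < e -> \forall n \near \oo, forall k, (k < n)%N ->
    `|\int[mu]_(u in `[0, t / n%:R * k.+1%:R]) g u
      - \int[mu]_(u in `[0, t / n%:R * k%:R]) g u
      - t / n%:R * g (t / n%:R * k%:R)| <= t / n%:R * e.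
Proof.
move=> t0 cg e e0; have [r r0 ru] := within_continuous_unif cg e0.
near=> n => k kn.
have n0 : 0 < n%:R :> R by rewrite ltr0n; near: n; exact: nbhs_infty_gt.
set h := t / n%:R.
have h0 : 0 <= h by rewrite divr_ge0// ltW.
have hr : h < r.
  rewrite ltr_pdivrMr// mulrC -ltr_pdivrMr//.
  by near: n; exact: nbhs_infty_gtr.
have kh (j : nat) : (j <= n)%N -> h * j%:R <= t.
  move=> jn; rewrite -mulrAC ler_pdivrMr// ler_wpM2l// ler_nat//.
have hk : h * k%:R <= h * k.+1%:R by rewrite ler_wpM2l// ler_nat.
have hS : h * k.+1%:R - h * k%:R = h by rewrite -mulrBr -natrB// subSnn mulr1.
have hk0 : 0 <= h * k%:R by rewrite mulr_ge0.
have sub : `]h * k%:R, h * k.+1%:R] `<=` `[0, t]%classic.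
  by apply: subset_itv; rewrite bnd_simp// kh.
have intg : mu.-integrable `[0, t] (EFin \o g).
  by apply: continuous_compact_integrable => //; exact: segment_compact.
rewrite Rintegral_itvB ?bnd_simp//; last first.
  by apply: integrableS intg => //; apply: subset_itv; rewrite bnd_simp// kh.
have intk : mu.-integrable `]h * k%:R, h * k.+1%:R] (EFin \o g).
  exact: integrableS intg.
have muk : mu `]h * k%:R, h * k.+1%:R]%classic = h%:E.
  (* For [t = 0] the mesh vanishes and the cell is empty. *)
  rewrite lebesgue_measure_itv/= lte_fin; case: ltP => [_|hk'].
    by rewrite -EFinB hS.
  by congr EFin; apply/le_anti; rewrite h0 -hS subr_le0 hk'.
have intc (x : R) : mu.-integrable `]h * k%:R, h * k.+1%:R] (EFin \o cst x).
  apply/integrableP; split; first exact/measurable_EFinP/measurable_cst.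
  by rewrite (eq_integral (cst `|x|%:E))// integral_cst//= muk -EFinM ltry.
have intcE (x : R) : \int[mu]_(u in `]h * k%:R, h * k.+1%:R]) cst x u = h * x.
  by rewrite Rintegral_cst// mulrC; congr (_ * _); exact: (congr1 fine muk).
rewrite -(intcE (g _)) -RintegralB// -(intcE e).
have intd : mu.-integrable `]h * k%:R, h * k.+1%:R]
    (EFin \o (fun u => g u - cst (g (h * k%:R)) u)).
  by apply: eq_integrable (integrableB _ intk (intc (g (h * k%:R)))).
rewrite (le_trans (le_normr_Rintegral _ intd))//; apply: le_Rintegral => //.
  by have := integrable_norm intd.
move=> u /= /[!in_itv]/= /andP[ku uk]; rewrite distrC ltW// ru//.
- by rewrite in_itv/= hk0 kh// ltnW.
- by rewrite in_itv/= (le_trans hk0 (ltW ku)) (le_trans uk)// kh.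
- rewrite distrC ger0_norm ?subr_ge0 ?(ltW ku)// (le_lt_trans _ hr)//.
  by rewrite -[leRHS]hS lerB.
Unshelve. all: by end_near. Qed.

Lemma Riemann_sum_cvg g t : 0 <= t -> {within `[0, t], continuous g} ->
  \sum_(k < n) t / n%:R * g (t / n%:R * k%:R) @[n --> \oo]
    --> \int[mu]_(u in `[0, t]) g u.
Proof.
move=> t0 cg; apply/cvgrPdist_le => e e0.
(* The [n] cell errors add up to at most e t / (t + 1) <= e; adding 1 covers [t = 0]. *)
have e1 : 0 < e / (t + 1) by rewrite divr_gt0// ltr_wpDl.
near=> n.
have n0 : n%:R != 0 :> R by rewrite pnatr_eq0 -lt0n; near: n; exact: nbhs_infty_gt.
pose I k := \int[mu]_(u in `[0, t / n%:R * k%:R]) g u.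
have -> : \int[mu]_(u in `[0, t]) g u = \sum_(k < n) (I k.+1 - I k).
  rewrite -(big_mkord xpredT (fun k => I k.+1 - I k)) telescope_sumr//.
  by rewrite /I divfK// mulr0 set_itv1 Rintegral_set1 subr0.
rewrite -sumrB (le_trans (ler_norm_sum _ _ _))//.
apply: (@le_trans _ _ (\sum_(k < n) t / n%:R * (e / (t + 1)))).
  apply: ler_sum => k _.
  rewrite /I; move: (k : nat) (ltn_ord k); near: n; exact: Riemann_step.
rewrite sumr_const card_ord -[_ *+ n]mulr_natr mulrAC divfK// mulrA.
by rewrite ler_pdivrMr ?ltr_wpDl// mulrC ler_wpM2l ?ltW// ltr_pwDr.
Unshelve. all: by end_near. Qed.

(* For the grid t_k = k t / n this is e^{-c (t - t_{k+1})}. *)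
Definition exp_weight c t (n k : nat) : R :=
  expR (- (c * (t / n%:R))) ^+ (n - k.+1).

Definition exp_weighted_sum c t B (n : nat) : R :=
  \sum_(k < n) exp_weight c t n k *
    (B (t / n%:R * k.+1%:R) - B (t / n%:R * k%:R)).

(** Reversing the order of summation gives the left Riemann sum of e^{-c u} over [0, t]. *)
Lemma exp_weight_sum_cvg c t : 0 <= t ->
  \sum_(k < n) t / n%:R * exp_weight c t n k @[n --> \oo] --> Psi c t.
Proof.
move=> t0.
have -> : (fun n => \sum_(k < n) t / n%:R * exp_weight c t n k) =
    fun n => \sum_(k < n) t / n%:R * expR (- (c * (t / n%:R * k%:R))).
  apply/funext => n; rewrite (reindex_inj rev_ord_inj)/=.
  apply: eq_bigr => k _; rewrite /exp_weight subnSK// subKn; last exact: ltnW.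
  by rewrite -expRM_natr mulNr !mulrA.
apply: (@Riemann_sum_cvg (fun u => expR (- (c * u)))) => //.
apply: continuous_subspaceT => u; apply: continuous_comp; last exact: continuous_expR.
by apply: cvgN; apply: cvgM; [exact: cvg_cst|exact: cvg_id].
Qed.

(** Discrete variation of constants for the recursion y_{k+1} = q y_k + f_k. *)
Lemma sum_geometric_telescope (q : R) (y : nat -> R) n :
  \sum_(k < n) q ^+ (n - k.+1) * (y k.+1 - q * y k) = y n - q ^+ n * y 0.
Proof.
elim: n => [|n IH]; first by rewrite big_ord0 expr0 mul1r subrr.
rewrite big_ord_recr/= subnn expr0 mul1r.
rewrite (eq_bigr (fun k : 'I_n => q * (q ^+ (n - k.+1) * (y k.+1 - q * y k)))).
  by rewrite -mulr_sumr IH exprS; ring.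
by move=> k _; rewrite mulrA -exprS -subSn.
Qed.

(** The inequality 1 + z <= e^z is used at z and at -z, the latter multiplied by e^z. The upper
    bound is of second order at 0. *)
Lemma expR_sub1_bounds (z : R) : 0 <= expR z - 1 - z <= z * (expR z - 1).
Proof.
have e1 := expR_ge1Dx z; have := expR_ge1Dx (- z).
rewrite -(ler_pM2r (expR_gt0 z)) -expRD addNr expR0 => e2.
by apply/andP; split; nra.
Qed.

(** With y_k = X(k h) - m and q = e^{-c h}, one step of the equation reads y_{k+1} - q y_k = s
    (B_{k+1} - B_k) + o(h), uniformly in k. Weighted by the bounded powers q^{n-k-1}, the left sides
    telescope to the limit and the n errors vanish in total. *)
Lemma mean_reverting_discretization (c m s x t : R) B X : 0 <= t ->
  {within `[0, t], continuous X} -> B 0 = 0 ->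
  (forall u, 0 <= u -> u <= t ->
    X u = x + \int[mu]_(v in `[0, u]) (c * (m - X v)) + s * B u) ->
  s * exp_weighted_sum c t B n @[n --> \oo]
    --> X t - (m + expR (- (c * t)) * (x - m)).
Proof.
move=> t0 cX B0 XE.
have cg : {within `[0, t], continuous (fun v => c * (m - X v))}.
  by move=> v; apply: cvgM; [exact: cvg_cst|apply: cvgB; [exact: cvg_cst|exact: cX]].
have [M M0 XM] : exists2 M, 0 < M & forall u, u \in `[0, t] -> `|X u - m| <= M.
  have cY : {within `[0, t], continuous (fun v => X v - m)}.
    by move=> v; apply: cvgB; [exact: cX|exact: cvg_cst].
  have /compact_bounded[M [_ XM]] := continuous_compact cY (@segment_compact _ _ _).
  exists (`|M| + 1); first by rewrite ltr_pwDr.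
  move=> u ut; apply: (XM (`|M| + 1)); first by rewrite ltr_pwDr// ler_norm.
  by exists u.
have X0 : X 0 = x by rewrite XE// set_itv1 Rintegral_set1 B0 mulr0 !addr0.
(* A bound for all the weights q^{n-k-1}, for [c] of either sign. *)
pose K := expR (`|c| * t).
have K0 : 0 < K by exact: expR_gt0.
apply/cvgrPdist_le => e e0.
(* Each step has two errors of size at most h e1, with weight at most [K]; as n h = t, the total is
   at most e t / (t + 1). *)
pose e1 := e / (2 * (t + 1) * K).
have t10 : 0 < t + 1 by rewrite ltr_wpDl.
have e10 : 0 < e1 by rewrite divr_gt0// !mulr_gt0.
(* Multiplied by h, the left side bounds the error of replacing 1 - q by c h. *)
have small_near : \forall n \near \oo,
    `|c| * `|expR (- (c * (t / n%:R))) - 1| * M <= e1.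
  have cvg0 : t / n%:R @[n --> \oo] --> (0 : R).
    rewrite -(mulr0 t); apply: cvgM; first exact: cvg_cst.
    apply/gtr0_cvgV0; last exact: cvgr_idn.
    by near=> n; rewrite ltr0n; near: n; exact: nbhs_infty_gt.
  have : `|c| * `|expR (- (c * (t / n%:R))) - 1| * M @[n --> \oo]
      --> `|c| * `|expR (- (c * 0)) - 1| * M.
    apply: cvgM; last exact: cvg_cst.
    apply: cvgM; first exact: cvg_cst.
    apply: cvg_norm; apply: cvgB; last exact: cvg_cst.
    apply: (cvg_comp _ expR); last exact: continuous_expR.
    by apply: cvgN; apply: cvgM; first exact: cvg_cst.
  rewrite mulr0 oppr0 expR0 subrr normr0 mulr0 mul0r => /cvgr_le; exact.
near=> n.
have n0 : 0 < n%:R :> R by rewrite ltr0n; near: n; exact: nbhs_infty_gt.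
have nn0 : n%:R != 0 :> R by rewrite gt_eqF.
pose h := t / n%:R; pose q := expR (- (c * h)).
have h0 : 0 <= h by rewrite divr_ge0// ltW.
pose I k := \int[mu]_(v in `[0, h * k%:R]) (c * (m - X v)).
pose y k := X (h * k%:R) - m.
have hk (k : nat) : (k <= n)%N -> h * k%:R <= t.
  by move=> kn; rewrite -mulrAC ler_pdivrMr// ler_wpM2l// ler_nat.
have qn : q ^+ n = expR (- (c * t)).
  by rewrite /q -expRM_natr mulNr -mulrA divfK.
have -> : X t - (m + expR (- (c * t)) * (x - m)) = y n - q ^+ n * y 0%N.
  by rewrite /y mulr0 X0 qn /h divfK//; ring.
rewrite -sum_geometric_telescope /exp_weighted_sum mulr_sumr -sumrB.
rewrite (le_trans (ler_norm_sum _ _ _))//.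
apply: (@le_trans _ _ (\sum_(k < n) h * (2 * e1 * K))); last first.
  rewrite sumr_const card_ord -[_ *+ n]mulr_natr mulrAC divfK//.
  rewrite /e1 [leLHS](_ : _ = e * (t / (t + 1))); last first.
    by field; rewrite !gt_eqF.
  by rewrite ler_piMr ?(ltW e0)// ler_pdivrMr// mul1r lerDl.
apply: ler_sum => k _.
have step : `|I k.+1 - I k - h * (c * (m - X (h * k%:R)))| <= h * e1.
  rewrite /I /h; move: (k : nat) (ltn_ord k); near: n; exact: (Riemann_step t0 cg).
have small : `|c| * `|q - 1| * M <= e1.
  by rewrite /q /h; near: n.
have qK : `|q ^+ (n - k.+1)| <= K.
  rewrite ger0_norm ?exprn_ge0 ?expR_ge0// /q -expRM_natr ler_expR.
  apply: (@le_trans _ _ (`|c| * (h * (n - k.+1)%:R))).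
    by rewrite [leRHS]mulrA ler_wpM2r// -[leLHS]mulNr ler_wpM2r// -normrN ler_norm.
  by rewrite ler_wpM2l// hk// leq_subr.
have Xstep : X (h * k.+1%:R) = X (h * k%:R) + (I k.+1 - I k)
    + s * (B (h * k.+1%:R) - B (h * k%:R)).
  by rewrite !XE ?hk ?mulr_ge0// ?(ltnW (ltn_ord k))// /I; ring.
(* The first error comes from freezing the drift at the left grid point, the second from linearizing
   q. *)
rewrite /exp_weight -/h -/q (_ : _ - _ = q ^+ (n - k.+1) *
    ((I k.+1 - I k - h * (c * (m - X (h * k%:R)))) + (1 - q - c * h) * y k)); last first.
  by rewrite /y Xstep; ring.
rewrite normrM mulrC (_ : h * (2 * e1 * K) = (h * e1 + h * e1) * K); last by ring.
rewrite ler_pM// (le_trans (ler_normD _ _))// lerD// normrM.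
have /andP[b1 b2] := expR_sub1_bounds (- (c * h)).
rewrite (_ : 1 - q - c * h = - (q - 1 - - (c * h))); last by ring.
rewrite normrN [`|_ - - _|]ger0_norm// (le_trans _ (ler_wpM2l h0 small))//.
rewrite [leRHS](_ : _ = (`|c| * h * `|q - 1|) * M); last by ring.
rewrite ler_pM//.
  rewrite (le_trans b2)// (le_trans (ler_norm _))// normrM normrN normrM.
  by rewrite (ger0_norm h0).
by rewrite XM// in_itv/= mulr_ge0// hk// ltnW.
Unshelve. all: by end_near. Qed.

End discretization.

(** * Gaussian sums *)

Section covariance_of_sums.
Context d (Omega : measurableType d) {R : realType} (P : probability Omega R).
Context {J : Type}.
Implicit Types (r : seq J) (c g : J -> R) (X : J -> Omega -> R) (Z : Omega -> R).

Let pairE c X j r : (fun w => c j * X j w + \sum_(k <- r) c k * X k w) =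
  (c j \o* X j) \+ (fun w => \sum_(k <- r) c k * X k w).
Proof. by apply/funext => w /=; rewrite mulrC. Qed.

Lemma Lfun2_sum r c X : (forall j, X j \in Lfun P 2%:E) ->
  (fun w => \sum_(j <- r) c j * X j w) \in Lfun P 2%:E.
Proof.
move=> X2; elim: r => [|j r IH].
  by under eq_fun do rewrite big_nil; rewrite Lfun_cst.
under eq_fun do rewrite big_cons.
rewrite pairE rpredD ?lee1n//= => *.
by rewrite Lfun_scale ?ler1n.
Qed.

Lemma covariance_suml r c X Z g : (forall j, X j \in Lfun P 2%:E) ->
  Z \in Lfun P 2%:E -> (forall j, covariance P (X j) Z = (g j)%:E) ->
  covariance P (fun w => \sum_(j <- r) c j * X j w) Z =
  (\sum_(j <- r) c j * g j)%:E.
Proof.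
move=> X2 Z2 XZ.
have Pfin : P setT \is a fin_num := fin_num_measure P _ measurableT.
elim: r => [|j r IH].
  by under eq_fun do rewrite big_nil; rewrite big_nil covariance_cst_l.
under eq_fun do rewrite big_cons.
rewrite big_cons pairE covarianceDl ?IH ?covarianceZl ?XZ//.
- exact: Lfun_subset12.
- exact: Lfun_subset12.
- exact: Lfun2_mul_Lfun1.
- by rewrite Lfun_scale ?ler1n.
- exact: Lfun2_sum.
Qed.

(** The covariance of the sum with itself is expanded on the left twice, with symmetry in between;
    hence the order of the indices in [G j i]. *)
Lemma variance_sum r c X (G : J -> J -> R) : (forall j, X j \in Lfun P 2%:E) ->
  (forall i j, covariance P (X i) (X j) = (G i j)%:E) ->
  ('V_P[(fun w => \sum_(j <- r) c j * X j w)%R] =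
  (\sum_(i <- r) c i * \sum_(j <- r) c j * G j i)%:E)%E.
Proof.
move=> X2 XG; apply: covariance_suml => //; first exact: Lfun2_sum.
by move=> i; rewrite covarianceC; exact: covariance_suml.
Qed.

Lemma expectation_sum0 r c X : (forall j, X j \in Lfun P 2%:E) ->
  (forall j, 'E_P[X j] = 0)%E -> ('E_P[(fun w => \sum_(j <- r) c j * X j w)%R] = 0)%E.
Proof.
move=> X2 X0.
have Pfin : P setT \is a fin_num := fin_num_measure P _ measurableT.
elim: r => [|j r IH].
  by under eq_fun do rewrite big_nil; rewrite expectation_cst.
under eq_fun do rewrite big_cons.
rewrite pairE expectationD ?IH ?expectationZl ?X0 ?mule0 ?adde0//.
- exact: Lfun_subset12.
- by rewrite Lfun_scale// Lfun_subset12.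
- by apply: (Lfun_subset12 Pfin); exact: Lfun2_sum.
Qed.

End covariance_of_sums.

(** * Weighted sums of Brownian increments and their limits *)

Section gaussian_sums.
Context d (Omega : measurableType d) {R : realType} (P : probability Omega R).
Context (n : nat) (C : 'M[R]_n) (W : 'I_n -> R -> {RV P >-> R}).
Hypothesis hW : correlated_brownian_motions C W.

(** Enumeration carries joint Gaussianity from ordinals to any finite index type, such as the
    triples of equation, grid cell and endpoint used below. *)
Lemma jointly_gaussian_sum (J : finType) (i : J -> 'I_n) (t c : J -> R) :
  (forall j, 0 <= t j) ->
  exists m v : R, is_normal P (fun w => \sum_j c j * W (i j) (t j) w) m v.
Proof.
move=> t0.
have [m [v H]] := cbm_gaussian hW (i \o enum_val) (c \o enum_val)
  (fun k : 'I_#|J| => t0 (enum_val k)).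
exists m, v; congr (is_normal P _ m v) : H.
apply/funext => w; rewrite -(big_enum_val (fun j => c j * W (i j) (t j) w)).
by apply: eq_bigl.
Qed.

Lemma brownian_is_normal (i : 'I_n) (t : R) : 0 <= t -> is_normal P (W i t) 0 t.
Proof.
move=> t0; have hB := cbm_standard hW i.
have := sbm_increment hB (lexx 0) t0; rewrite subr0.
apply: ae_eq_is_normal => //.
by apply: filterS (sbm_start hB) => w ->; rewrite subr0.
Qed.

Lemma brownian_Lfun2 (i : 'I_n) (t : R) : 0 <= t ->
  (W i t : Omega -> R) \in Lfun P 2%:E.
Proof. by move=> /(brownian_is_normal i)/is_normal_moments[]. Qed.

Lemma brownian_expectation (i : 'I_n) (t : R) : 0 <= t -> ('E_P[W i t] = 0)%E.
Proof. by move=> /(brownian_is_normal i)/is_normal_moments[]. Qed.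

Lemma covariance_grid_increment (i j : 'I_n) (h : R) (k l : nat) : 0 <= h ->
  covariance P (W i (h * k.+1%:R) \- W i (h * k%:R))
               (W j (h * l.+1%:R) \- W j (h * l%:R)) =
  (C i j * (h * (k == l)%:R))%:E.
Proof.
move=> h0.
have hk (a : nat) : 0 <= h * a%:R by rewrite mulr_ge0.
have L i' (a : nat) : (W i' (h * a%:R) : Omega -> R) \in Lfun P 2%:E.
  exact: brownian_Lfun2.
have cov (a b : nat) : covariance P (W i (h * a%:R)) (W j (h * b%:R)) =
    (C i j * (h * (minn a b)%:R))%:E.
  rewrite (cbm_covariance hW)//; congr (_ * _)%:E.
  by rewrite natr_min -minr_pMr.
have L' : W j (h * l.+1%:R) \- W j (h * l%:R) \in Lfun P 2%:E.
  by rewrite rpredB ?lee1n//= => *.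
rewrite covarianceBl// !covarianceBr// !cov -!EFinB; congr EFin.
(* The mixed second difference of the minimum is the Kronecker delta, stated additively because
   subtraction on [nat] truncates. *)
have key : (minn k.+1 l.+1 + minn k l = minn k.+1 l + minn k l.+1 + (k == l))%N.
  by case: eqVneq => kl; lia.
have E := congr1 (fun a : nat => a%:R : R) key; rewrite !natrD in E.
by rewrite -!mulrBr; congr (_ * (_ * _)); lra.
Qed.

(** Turns the products of weights in a covariance into weights of rate c + c', whose Riemann sums
    converge to Psi(c + c', t). *)
Lemma exp_weightD (c c' t : R) (N k : nat) :
  exp_weight (c + c') t N k = exp_weight c t N k * exp_weight c' t N k.
Proof. by rewrite /exp_weight -exprMn -expRD mulrDl opprD. Qed.

(** Joint Gaussianity gives a normal law with unspecified parameters. They are identified as mean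
    and variance: the increments are centred, and those over distinct cells are uncorrelated. *)
Lemma is_normal_exp_weighted_sum (q : nat) (g : 'I_q -> 'I_n) (a c : 'I_q -> R)
    (t : R) (N : nat) : 0 <= t ->
  is_normal P
    (fun w => \sum_(i < q) a i * exp_weighted_sum (c i) t (fun u => W (g i) u w) N)
    0 (\sum_(i < q) \sum_(j < q) a i * a j * C (g j) (g i) *
         \sum_(k < N) t / N%:R * exp_weight (c i + c j) t N k).
Proof.
move=> t0; pose h := t / N%:R.
have h0 : 0 <= h by rewrite divr_ge0.
pose D (p : 'I_q * 'I_N) : Omega -> R :=
  W (g p.1) (h * p.2.+1%:R) \- W (g p.1) (h * p.2%:R).
pose b (p : 'I_q * 'I_N) := a p.1 * exp_weight (c p.1) t N p.2.
have DE : (fun w => \sum_(i < q) a i *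
      exp_weighted_sum (c i) t (fun u => W (g i) u w) N) =
    (fun w => \sum_p b p * D p w).
  apply/funext => w; rewrite -(pair_bigA _ (fun i k => b (i, k) * D (i, k) w))/=.
  apply: eq_bigr => i _; rewrite mulr_sumr; apply: eq_bigr => k _.
  by rewrite mulrA.
(* The boolean selects an endpoint of the cell: [false] the right one with sign +1, [true] the left
   one with sign -1. *)
have DW : (fun w => \sum_p b p * D p w) =
    (fun w => \sum_(p : ('I_q * 'I_N) * bool)
       (b p.1 * (-1) ^+ p.2) * W (g p.1.1) (h * (p.1.2 + ~~ p.2)%:R) w).
  apply/funext => w.
  rewrite -(pair_bigA _ (fun p (s : bool) =>
    (b p * (-1) ^+ s) * W (g p.1) (h * (p.2 + ~~ s)%:R) w))/=.
  apply: eq_bigr => p _; rewrite big_bool/= /D/= addn0 addn1 expr0 expr1.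
  ring.
have [m [v]] := jointly_gaussian_sum
  (fun p : ('I_q * 'I_N) * bool => g p.1.1)
  (t := fun p => h * (p.1.2 + ~~ p.2)%:R) (fun p => b p.1 * (-1) ^+ p.2)
  (fun p => mulr_ge0 h0 (ler0n _ _)).
rewrite DE -DW => XN; have [_ Em Vv] := is_normal_moments XN.
have hk (k : nat) : 0 <= h * k%:R by rewrite mulr_ge0.
have D2 p : D p \in Lfun P 2%:E.
  by rewrite rpredB ?lee1n//= => *; exact: brownian_Lfun2.
have D0 p : ('E_P[D p] = 0)%E.
  have Pfin : P setT \is a fin_num := fin_num_measure P _ measurableT.
  rewrite expectationB ?brownian_expectation ?sube0//.
    by apply: (Lfun_subset12 Pfin); exact: brownian_Lfun2.
  by apply: (Lfun_subset12 Pfin); exact: brownian_Lfun2.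
have m0 : m = 0.
  by apply: EFin_inj; rewrite -Em; exact: expectation_sum0.
have vE : v = \sum_p b p * \sum_p' b p' * (C (g p'.1) (g p.1) * (h * (p'.2 == p.2 :> nat)%:R)).
  apply: EFin_inj; rewrite -Vv; apply: variance_sum => // p p'.
  exact: covariance_grid_increment.
move: XN; rewrite m0 vE; congr (is_normal P _ 0).
rewrite -(pair_bigA _ (fun i k => b (i, k) * \sum_p' b p' *
  (C (g p'.1) (g i) * (h * (p'.2 == k :> nat)%:R))))/=.
apply: eq_bigr => i _.
transitivity (\sum_(k < N) \sum_(j < q)
    a i * a j * C (g j) (g i) * (h * exp_weight (c i + c j) t N k)).
  apply: eq_bigr => k _.
  rewrite -(pair_bigA _ (fun j l => b (j, l) *
    (C (g j) (g i) * (h * (l == k :> nat)%:R))))/= mulr_sumr.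
  (* Only the cell [l = k] contributes. *)
  apply: eq_bigr => j _; rewrite (bigD1 k)//= big1 ?addr0.
    by rewrite eqxx exp_weightD /b/=; ring.
  by move=> l /negbTE lk; rewrite -val_eqE/= in lk; rewrite lk !mulr0.
by rewrite exchange_big/=; apply: eq_bigr => j _; rewrite mulr_sumr.
Qed.

Lemma is_normal_mean_reverting (q : nat) (g : 'I_q -> 'I_n)
    (a c m s x : 'I_q -> R) (X : 'I_q -> R -> {RV P >-> R}) (t : R) : 0 <= t ->
  (forall i, solves_mean_reverting_sde (c i) (m i) (s i) (x i) (W (g i)) (X i)) ->
  is_normal P (fun w => \sum_(i < q) a i * X i t w)
    (\sum_(i < q) a i * (m i + expR (- (c i * t)) * (x i - m i)))
    (\sum_(i < q) \sum_(j < q)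
       (a i * s i) * (a j * s j) * C (g j) (g i) * Psi (c i + c j) t).
Proof.
move=> t0 hX.
set mean := (Y in is_normal _ _ Y _).
apply: (is_normal_lim (v_ := fun N => \sum_(i < q) \sum_(j < q)
    (a i * s i) * (a j * s j) * C (g j) (g i) *
    \sum_(k < N) t / N%:R * exp_weight (c i + c j) t N k)
  (X_ := fun N w => mean + \sum_(i < q) (a i * s i) *
    exp_weighted_sum (c i) t (fun u => W (g i) u w) N)).
- move=> N; have := is_normal_shift mean
    (is_normal_exp_weighted_sum g (fun i => a i * s i) c N t0).
  by rewrite addr0.
- by apply: measurable_sum => i; exact: measurable_funM.
- have key i : {ae P, forall w,
      s i * exp_weighted_sum (c i) t (fun u => W (g i) u w) N @[N --> \oo]
        --> X i t w - (m i + expR (- (c i * t)) * (x i - m i))}.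
    have [cX XE] := hX i.
    have B0 := sbm_start (cbm_standard hW (g i)).
    move: cX XE B0; apply: filterS3 => w cw Xw Bw.
    apply: (@mean_reverting_discretization _ _ _ _ _ _ (fun u => W (g i) u w)
      (fun u => X i u w)) => //; last by move=> u u0 _; exact: Xw.
    by apply: continuous_subspaceW cw; apply: subset_itvl.
  (* The finitely many exceptional null sets, one per equation, are merged. *)
  apply: filterS (filter_forall _ key) => w Xw.
  have -> : \sum_(i < q) a i * X i t w = mean +
      \sum_(i < q) a i * (X i t w - (m i + expR (- (c i * t)) * (x i - m i))).
    by rewrite /mean -big_split/=; apply: eq_bigr => i _; ring.
  apply: cvgD; first exact: cvg_cst.
  apply: cvg_big => [|i _]; [exact: add_continuous|]; under eq_fun do rewrite -mulrA.
  by apply: cvgM; [exact: cvg_cst|exact: Xw].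
- apply: cvg_big => [|i _]; [exact: add_continuous|]; apply: cvg_big => [|j _]; [exact: add_continuous|].
  by apply: cvgM; [exact: cvg_cst|exact: exp_weight_sum_cvg].
Qed.

End gaussian_sums.

(** * The five-factor model *)

Section model_matrices.
Context {R : realType} (p : parameters R) (w : 'cV[R]_3).

Let w0 := w ord0 0.
Let w1 := w (lift ord0 ord0) 0.
Let w2 := w (lift ord0 (lift ord0 ord0)) 0.

(* The loading of w' L on W^r is [rate_exposure * sigma_r p]. *)
Definition rate_exposure : R :=
  - Psi (mpr_a p) (tau_B p) * w1 - Psi (mpr_a p) (tau_D p) * w2.

(** Each volatility is kept next to its component of [v], where it cancels the denominator in
    [market_prices]. *)
Lemma portfolio_drift (v : 'cV[R]_4) : (w^T *m L_mx p *m v) 0 0 =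
  w0 * (sigma_S p * v idx_S 0) + rate_exposure * (sigma_r p * v idx_r 0) +
  Psi (mpr_k p) (tau_D p) * w2 * (sigma_pi p * v idx_pi 0) +
  w2 * (sigma_I p * v idx_I 0).
Proof.
rewrite !mxE !big_ord_recl !big_ord0 !mxE !big_ord_recl !big_ord0 !mxE /=.
have -> : lift ord0 ord0 = idx_r by exact: val_inj.
have -> : lift ord0 (lift ord0 ord0) = idx_pi by exact: val_inj.
have -> : lift ord0 (lift ord0 (lift ord0 ord0)) = idx_I by exact: val_inj.
have -> : ord0 = idx_S by exact: val_inj.
rewrite /rate_exposure /w0 /w1 /w2; ring.
Qed.

(** This is the quadratic form u' V(t) u at u = M' w, whose entries are [u0], [u1], [u2]. *)
Lemma portfolio_diffusion (t : R) :
  (w^T *m M_mx p *m V_mx p t *m (M_mx p)^T *m w) 0 0 =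
  let u0 := sigma_x p * w0 in
  let u1 := rate_exposure * (mpr_a p - kappa p) * sigma_r p in
  let u2 := Psi (mpr_k p) (tau_D p) * w2 * (mpr_k p - beta p) * sigma_pi p in
  u0 * u0 * Psi (2 * alpha p) t + u1 * u1 * Psi (2 * kappa p) t +
  u2 * u2 * Psi (2 * beta p) t
  - 2 * u0 * u1 * rho_rS p * Psi (kappa p + alpha p) t
  - 2 * u0 * u2 * rho_Spi p * Psi (alpha p + beta p) t
  + 2 * u1 * u2 * rho_rpi p * Psi (kappa p + beta p) t.
Proof.
set u := (M_mx p)^T *m w.
have -> : w^T *m M_mx p *m V_mx p t *m (M_mx p)^T *m w = u^T *m V_mx p t *m u.
  by rewrite /u trmx_mul trmxK !mulmxA.
have u0E : u ord0 0 = sigma_x p * w0.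
  by rewrite !mxE !big_ord_recl !big_ord0 !mxE /= /w0; ring.
have u1E : u (lift ord0 ord0) 0 =
    rate_exposure * (mpr_a p - kappa p) * sigma_r p.
  rewrite !mxE !big_ord_recl !big_ord0 !mxE /= /rate_exposure /w1 /w2; ring.
have u2E : u (lift ord0 (lift ord0 ord0)) 0 =
    Psi (mpr_k p) (tau_D p) * w2 * (mpr_k p - beta p) * sigma_pi p.
  rewrite !mxE !big_ord_recl !big_ord0 !mxE /= /w2; ring.
clearbody u.
rewrite !mxE !big_ord_recl !big_ord0 !mxE !big_ord_recl !big_ord0.
rewrite ![u^T _ _]mxE ![V_mx p t _ _]mxE /= -u0E -u1E -u2E.
move: (u ord0 0) (u (lift ord0 ord0) 0) (u (lift ord0 (lift ord0 ord0)) 0).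
move: (Psi _ t) (Psi _ t) (Psi _ t) (Psi _ t) (Psi _ t) (Psi _ t).
move: (rho_rS p) (rho_Spi p) (rho_rpi p) => *.
ring.
Qed.

End model_matrices.

(** * Law and moments of the Sharpe ratio *)

Unset Implicit Arguments.
Theorem proposition7p1 (R : realType) (d : measure_display)
  (Omega : measurableType d) (P : probability Omega R) (p : parameters R)
  (W : 'I_4 -> R -> {RV P >-> R}) (r x pi : R -> {RV P >-> R})
  (w : 'cV[R]_3) (t : R)
  (hsigma_x : 0 <= sigma_x p) (hsigma_S : 0 < sigma_S p)
  (hsigma_r : 0 < sigma_r p) (hsigma_pi : 0 < sigma_pi p)
  (hsigma_I : 0 < sigma_I p) (htau_B : 0 < tau_B p) (htau_D : 0 < tau_D p)
  (hW : correlated_brownian_motions (corr_mx p) W)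
  (hr : solves_mean_reverting_sde
          (kappa p) (rbar p) (sigma_r p) (r0 p) (W idx_r) r)
  (hx : solves_mean_reverting_sde
          (alpha p) (xbar p) (- sigma_x p) (x0 p) (W idx_S) x)
  (hpi : solves_mean_reverting_sde
          (beta p) (pibar p) (sigma_pi p) (pi0 p) (W idx_pi) pi)
  (hw : 0 < portfolio_variance p w) (ht : 0 <= t) :
  let lambda := fun omega => market_prices p (r t omega) (x t omega) (pi t omega) in
  let SR := fun omega => sharpe_ratio p w (lambda omega) in
  let mean := (w^T *m L_mx p *m mean_market_prices p t) 0 0
                / Num.sqrt (portfolio_variance p w) in
  let var := (w^T *m M_mx p *m V_mx p t *m (M_mx p)^T *m w) 0 0
               / portfolio_variance p w in
  [/\ is_normal P SR mean var,
      forall i : 'I_4, 'E_P[fun omega => lambda omega i (0 : 'I_1)%R]%E =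
                       (mean_market_prices p t i 0)%:E,
      'E_P[SR]%E = mean%:E
    & 'V_P[SR]%E = var%:E].
Proof.
move=> lambda SR mean var.
(* The states are listed as x, r, pi, the order of the rows of [V_mx]; the defaults of [nth] are
   never reached. *)
pose g (i : 'I_3) := nth idx_S [:: idx_S; idx_r; idx_pi] i.
pose c (i : 'I_3) := nth 0 [:: alpha p; kappa p; beta p] i.
pose m (i : 'I_3) := nth 0 [:: xbar p; rbar p; pibar p] i.
(* The sign of the first entry accounts for the minus signs in [V_mx], since [M_mx] contains
   [sigma_x] itself. *)
pose s (i : 'I_3) := nth 0 [:: - sigma_x p; sigma_r p; sigma_pi p] i.
pose y (i : 'I_3) := nth 0 [:: x0 p; r0 p; pi0 p] i.
pose X (i : 'I_3) := nth x [:: x; r; pi] i.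
have hX i : solves_mean_reverting_sde (c i) (m i) (s i) (y i) (W (g i)) (X i).
  by case: i => [[|[|[|]]]].
have gauss e (a : 'I_3 -> R) :=
  is_normal_shift e (is_normal_mean_reverting hW (g := g) a ht hX).
have mulfVK (q u : R) : 0 < q -> q * (u / q) = u.
  by move=> q0; rewrite mulrCA divff ?mulr1// gt_eqF.
have Psi2 (u : R) : Psi (2 * u) t = Psi (u + u) t by rewrite mulr2n mulrDl mul1r.
set pv := portfolio_variance p w in SR mean var hw *.
pose z := (Num.sqrt pv)^-1.
(* The normalization enters each coefficient through one factor [z], hence the variance through
   [z * z]. *)
have zz : pv^-1 = z * z by rewrite -invfM -expr2 sqr_sqrtr// ltW.
pose w0 := w ord0 0.
pose w2 := w (lift ord0 (lift ord0 ord0)) 0.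
pose pB := rate_exposure p w.
pose pD := Psi (mpr_k p) (tau_D p) * w2.
(* The coefficients of x, r, pi in the Sharpe ratio; [e] is its constant term. *)
pose a (i : 'I_3) := nth 0 [:: w0 * z; pB * (mpr_a p - kappa p) * z;
  pD * (mpr_k p - beta p) * z] i.
pose e := (pB * (kappa p * rbar p - mpr_a p * mpr_b p)
  + pD * (beta p * pibar p - mpr_k p * mpr_l p) + w2 * mpr_h p) * z.
have normalSR : is_normal P SR mean var.
  have := gauss e a; congr is_normal.
  - apply/funext => omega; rewrite /SR /sharpe_ratio -/pv -/z portfolio_drift.
    rewrite !mxE /= !mulfVK// !big_ord_recl !big_ord0 /a /e /pB /pD /w2 /w0 /=.
    ring.
  - rewrite /mean -/z portfolio_drift !mxE /= !mulrDr !mulfVK//.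
    rewrite !big_ord_recl !big_ord0 /a /e /c /m /y /pB /pD /w2 /w0 /=.
    ring.
  - rewrite /var zz portfolio_diffusion !Psi2 /=.
    rewrite !big_ord_recl !big_ord0 /a /s /c /= !mxE /=.
    (* The sums of rates are put in the order used in [V_mx], so that equal values of [Psi] become
       syntactically equal. *)
    rewrite [alpha p + kappa p]addrC [beta p + alpha p]addrC [beta p + kappa p]addrC.
    rewrite /pB /pD /w2 /w0.
    move: (Psi _ _) (Psi _ t) (Psi _ t) (Psi _ t) (Psi _ t) (Psi _ t) (Psi _ t).
    move: (rho_rS p) (rho_Spi p) (rho_rpi p) (rate_exposure p w).
    move: (sigma_x p) (sigma_r p) (sigma_pi p) (mpr_a p) (mpr_k p) (kappa p) (beta p).
    move: (w ord0 0) (w _ 0) => *.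
    ring.
have [_ ESR VSR] := is_normal_moments normalSR.
(* Each market price of risk is also affine in the states, with coefficients [b] and constant term
   [f], so its mean comes from the same normal law. *)
have mprE (i : 'I_4) (b : seq R) (f : R) :
    (forall omega, lambda omega i 0 = f + \sum_(j < 3) b`_j * X j t omega) ->
    f + \sum_(j < 3) b`_j * (m j + expR (- (c j * t)) * (y j - m j)) =
      mean_market_prices p t i 0 ->
    'E_P[fun omega => lambda omega i (0 : 'I_1)%R]%E =
      (mean_market_prices p t i 0)%:E.
  move=> lb <-; have [_ <- _] := is_normal_moments (gauss f (fun j => b`_j)).
  by congr expectation; apply/funext.
split => //; case=> [[|[|[|[|//]]]] hi].
- apply: (mprE _ [:: (sigma_S p)^-1; 0; 0] 0) => [omega|];
    rewrite !big_ord_recl !big_ord0 !mxE /c /m /y /=; ring.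
- apply: (mprE _ [:: 0; (mpr_a p - kappa p) / sigma_r p; 0]
    ((kappa p * rbar p - mpr_a p * mpr_b p) / sigma_r p)) => [omega|];
    rewrite !big_ord_recl !big_ord0 !mxE /c /m /y /=; ring.
- apply: (mprE _ [:: 0; 0; (mpr_k p - beta p) / sigma_pi p]
    ((beta p * pibar p - mpr_k p * mpr_l p) / sigma_pi p)) => [omega|];
    rewrite !big_ord_recl !big_ord0 !mxE /c /m /y /=; ring.
- apply: (mprE _ [:: 0; 0; 0] (mpr_h p / sigma_I p)) => [omega|];
    rewrite !big_ord_recl !big_ord0 !mxE /c /m /y /=; ring.
Qed.
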